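(* For every real $c>0$ there exist positive real numbers $A$ and $B$, depending only on $c$, and a constant $C>0$, depending only on $c$, such that the following holds. Let $X>2$ be real and let $\alpha\in\mathbb{R}$ be such that $$\alpha=\frac{a}{q}+\frac{\theta}{q^2},\quad (a,q)=1,\quad |\theta|<1,\quad (\log X)^A<q\le X(\log X)^{-B},$$ for some integers $a$ and $q\ge 1$ and some real $\theta$. Then $$\left|\sum_{n\le X,\ n\in\mathbb{N}_0}e(\alpha n^2)\right|\le C\,X(\log X)^{-c}.$$
   Context: Every positive integer $n$ has a binary expansion $n=\sum_{k\ge 0}\varepsilon_k 2^k$ with $\varepsilon_k\in\{0,1\}$. $\mathbb{N}_0$ denotes the set of positive integers $n$ for which $\sum_k\varepsilon_k$ is even. Write $e(x)=\exp(2\pi i x)$; $(a,q)$ is the greatest common divisor and $\log$ is the natural logarithm. *)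

(* Defs.v *)
From mathcomp Require Import all_boot all_order all_algebra.
From mathcomp Require Import complex.
From mathcomp Require Import reals sequences exp trigo.

Set Implicit Arguments.
Unset Strict Implicit.
Unset Printing Implicit Defensive.

Import Order.TTheory GRing.Theory Num.Theory.

Local Open Scope ring_scope.
Local Open Scope complex_scope.

Definition binary_digit (n k : nat) : bool := odd (n %/ 2 ^ k)%N.

(* Since n < 2 ^ n, the digits of index k >= n all vanish. *)
Definition binary_digit_sum (n : nat) : nat :=
  (\sum_(k < n) binary_digit n k)%N.

Lemma binary_expansion_mod (n m : nat) :
  (n %% 2 ^ m = \sum_(k < m) binary_digit n k * 2 ^ k)%N.
Proof.
elim: m => [|m IHm]; first by rewrite big_ord0 modn1.
rewrite big_ord_recr /= -IHm /binary_digit expnS mulnC.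
rewrite {1}(divn_eq n (2 ^ m)) {1}(divn_eq (n %/ 2 ^ m) 2) modn2.
rewrite mulnDl -mulnA -addnA (mulnC 2) modnMDl modn_small; first by rewrite addnC.
have := ltn_pmod n (expn_gt0 2 m).
case: (odd _); rewrite ?mul1n ?mul0n ?add0n => lt_mod; first by rewrite muln2 -addnn ltn_add2l.
by rewrite (leq_trans lt_mod) // leq_pmulr.
Qed.

Lemma binary_expansion (n : nat) :
  n = (\sum_(k < n) binary_digit n k * 2 ^ k)%N.
Proof. by rewrite -binary_expansion_mod modn_small // ltn_expl. Qed.

Definition N0 : pred nat :=
  [pred n | (0 < n)%N && ~~ odd (binary_digit_sum n)].

(* The complex exponential: exp (x + iy) = exp x * (cos y + i sin y). *)
Definition cexp (R : realType) (z : R[i]) : R[i] :=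
  (expR (complex.Re z))%:C * (cos (complex.Im z) +i* sin (complex.Im z)).

Definition e (R : realType) (x : R) : R[i] :=
  cexp ('i * (2 * pi * x)%:C).

Lemma eE (R : realType) (x : R) :
  e x = cos (2 * pi * x) +i* sin (2 * pi * x).
Proof. by rewrite /e /cexp; simpc; rewrite expR0 !mul1r. Qed.

(* Main.v *)
Require Import Defs.
From mathcomp Require Import all_boot all_order all_algebra.
From mathcomp Require Import complex.
From mathcomp Require Import reals sequences exp trigo.
From mathcomp Require Import zify ring lra.
Import Order.TTheory GRing.Theory Num.Theory.
Local Open Scope ring_scope.
Local Open Scope complex_scope.

(** The parity condition is made independent of the analysis by cutting the sum
into blocks of length Q = 2 ^ M.  Writing n = u * Q + v with v < Q,
the binary digit sum of n is the sum of those of u and v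
([binary_digit_sum_shift]), so within the block of index u the condition on n
only prescribes the parity of the digit sum of v.  For each of the two
parities, let T(u) be the sum of e (alpha * (u * Q + v) ^ 2) over the v < Q of
that parity.

By Cauchy-Schwarz over the U blocks, it is enough to bound the sum over u of
|T(u)| ^ 2.  Expanding the square and summing over u first
([almost_orthogonal_bound]), the pairs (v, v) contribute at most Q * U, and a
pair v <> w contributes, up to a unimodular factor, the sum over u of
e (2 * Q * (v - w) * alpha * u): the squares u ^ 2 Q ^ 2 cancel, so the phase is
linear in u and the sum is geometric.  The multipliers h = 2 * Q * (v - w)
satisfy 0 < 2 * |h| <= q as soon as 4 * Q ^ 2 <= q, and then alpha * h stays at
distance at least 1 / (2 * q) from the integers
([rational_approximation_far]); hence each of these geometric sums is at most
2 * q ([geometric_e_bound]).  Altogether the sum over N0 is at most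

    1 + Q + sqrt (2 * U * (Q * U + 2 * Q ^ 2 * q)),  where U * Q <= X.

Taking Q of the exact order of (log X) ^ (2 * c), the term U ^ 2 * Q saves the
factor (log X) ^ (2 * c) from X ^ 2, and U * Q ^ 2 * q saves the same when
q <= X * (log X) ^ (- 4 * c), that is B = 4 * c.  The condition 4 * Q ^ 2 <= q
follows from q > (log X) ^ (4 * c + 1) when log X >= 4, whence A = 4 * c + 1;
for log X < 4 the trivial bound by X suffices. *)

(** * Mean squares of sums of almost orthogonal vectors *)

Lemma sqr_sum_le (C : numDomainType) (n : nat) (a : 'I_n -> C) :
  (forall i, a i \is Num.real) ->
  (\sum_i a i) ^+ 2 <= n%:R * \sum_i a i ^+ 2.
Proof.
move=> ra; rewrite -(ler_pMn2r (n := 2)) // expr2 mulr_suml -sumrMnl.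
have -> : (n%:R * \sum_i a i ^+ 2) *+ 2 = \sum_(i < n) \sum_(j < n) (a i ^+ 2 + a j ^+ 2).
  under [RHS]eq_bigr do rewrite big_split /= sumr_const card_ord.
  by rewrite big_split /= sumr_const card_ord sumrMnl mulr2n mulr_natl.
apply: ler_sum => i _; rewrite mulr_sumr -sumrMnl; apply: ler_sum => j _.
by have [] := real_leif_mean_square_scaled (ra i) (ra j).
Qed.

(** A dual large sieve with no structure on the vectors: after expanding the
square, the diagonal costs at most Q * U and each of the at most Q ^ 2 remaining
pairs costs G.  The subfamily P is arbitrary because the bound is taken termwise in
absolute value. *)
Lemma almost_orthogonal_bound (C : numClosedFieldType) (Q U : nat)
    (P : pred 'I_Q) (x : 'I_Q -> 'I_U -> C) (G : C) : 0 <= G ->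
    (forall v u, `|x v u| <= 1) ->
    (forall v w, v != w -> `|\sum_u x v u * (x w u)^*| <= G) ->
  \sum_u `|\sum_(v | P v) x v u| ^+ 2 <= Q%:R * U%:R + Q%:R ^+ 2 * G.
Proof.
move=> G0 x1 xG.
have S0 : 0 <= \sum_u `|\sum_(v | P v) x v u| ^+ 2.
  by apply: sumr_ge0 => u _; apply: exprn_ge0.
rewrite -(ger0_norm S0).
have -> : \sum_u `|\sum_(v | P v) x v u| ^+ 2 =
    \sum_(v | P v) \sum_(w | P w) \sum_u x v u * (x w u)^*.
  under eq_bigr do rewrite normCK rmorph_sum big_distrlr /=.
  rewrite exchange_big; apply: eq_bigr => v _.
  by rewrite exchange_big.
have -> : Q%:R * U%:R + Q%:R ^+ 2 * G =
    \sum_(v < Q) \sum_(w < Q) ((if w == v then U%:R else 0) + G) :> C.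
  under [RHS]eq_bigr do rewrite big_split /= -big_mkcond big_pred1_eq sumr_const card_ord.
  by rewrite sumr_const card_ord -[G *+ Q]mulr_natl -[RHS]mulr_natl mulrDr mulrA expr2.
have term0 v w : 0 <= (if w == v then U%:R else 0) + G.
  by rewrite addr_ge0 //; case: ifP.
apply: le_trans (ler_norm_sum _ _ _) _.
rewrite big_mkcond; apply: ler_sum => v _; case: ifP => _; last exact: sumr_ge0.
apply: le_trans (ler_norm_sum _ _ _) _.
rewrite big_mkcond; apply: ler_sum => w _; case: ifP => _; last exact: term0.
have [->|neq_wv] := eqVneq w v; last by rewrite add0r xG // eq_sym.
rewrite ler_wpDr //; apply: le_trans (ler_norm_sum _ _ _) _.
have -> : U%:R = \sum_(u < U) 1 :> C by rewrite sumr_const card_ord.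
apply: ler_sum => u _.
by rewrite normrM norm_conjC mulr_ile1.
Qed.

(** * Binary digit sums of concatenated expansions *)

Lemma binary_digit_sumE (n m : nat) : (n < 2 ^ m)%N ->
  binary_digit_sum n = (\sum_(k < m) binary_digit n k)%N.
Proof.
have big_enough k : (n < 2 ^ k)%N ->
    forall j, (\sum_(i < k + j) binary_digit n i = \sum_(i < k) binary_digit n i)%N.
  move=> lt_n j; rewrite big_split_ord /= [X in (_ + X)%N]big1 ?addn0 // => i _.
  by rewrite /binary_digit divn_small // expnD (leq_trans lt_n) // leq_pmulr ?expn_gt0.
move=> lt_n; rewrite /binary_digit_sum -(big_enough n (ltn_expl _ _) m) //.
by rewrite addnC big_enough.
Qed.

(** The binary expansion of u * 2 ^ M + v is that of u followed by the M digits
of v, since no carry occurs. *)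
Lemma binary_digit_sum_shift (M u v : nat) : (v < 2 ^ M)%N ->
  binary_digit_sum (u * 2 ^ M + v) = (binary_digit_sum v + binary_digit_sum u)%N.
Proof.
move=> lt_v; have lt_u := ltn_expl u (ltnSn 1).
rewrite (@binary_digit_sumE _ (M + u)); last first.
  rewrite expnD mulnC -ltn_subRL -mulnBr.
  by rewrite (leq_trans lt_v) // leq_pmulr // subn_gt0.
rewrite big_split_ord /= (@binary_digit_sumE v M) // (@binary_digit_sumE u u) //.
congr (_ + _)%N; apply: eq_bigr => i _; congr (nat_of_bool _); rewrite /binary_digit.
  have -> : (2 ^ M = 2 ^ (M - i) * 2 ^ i)%N by rewrite -expnD subnK // ltnW.
  rewrite mulnA divnMDl ?expn_gt0 //.
  by rewrite oddD oddM oddX subn_eq0 leqNgt ltn_ord andbF.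
by rewrite expnD divnMA divnMDl ?expn_gt0 // (divn_small lt_v) addn0.
Qed.

(** * The additive character and its geometric sums *)

Section Exponential.
Variable R : realType.
Implicit Types x y : R.

Lemma e_add x y : e (x + y) = e x * e y.
Proof. by rewrite !eE mulrDr cosD sinD; simpc; congr (_ +i* _); rewrite addrC. Qed.

Lemma e_zero : e (0 : R) = 1.
Proof. by rewrite eE mulr0 cos0 sin0. Qed.

Lemma norm_e x : `|e x| = 1.
Proof. by rewrite normc_def eE /= cos2Dsin2 sqrtr1. Qed.

Lemma e_opp x : e (- x) = (e x)^*%R.
Proof.
have e_neq0 : e x != 0 by rewrite -normr_eq0 norm_e oner_neq0.
apply: (mulfI e_neq0); rewrite -e_add subrr e_zero -normCK norm_e expr1n //.
Qed.

Lemma e_mulrn x (k : nat) : e (x * k%:R) = e x ^+ k.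
Proof. by elim: k => [|k IHk]; rewrite ?mulr0 ?e_zero // exprS -IHk mulrS mulrDr mulr1 e_add. Qed.

Lemma e_int (m : int) : e (m%:~R : R) = 1.
Proof.
have e_nat (k : nat) : e (k%:R : R) = 1.
  by rewrite -[k%:R]mul1r e_mulrn eE mulr1 mulr_natl cos2pi sin2pi expr1n.
case: m => k; rewrite ?NegzE ?mulrNz; first exact: e_nat.
by rewrite e_opp e_nat rmorph1.
Qed.

(** Jordan's inequality for chords, without calculus: some multiple k * x lies in
[1/4, 1/2], where the chord from 1 to e (k * x) has length at least 1 because
the cosine is nonpositive there; and that chord is at most k times the
chord from 1 to e x. *)
Lemma chord_ge_of_small x : 0 < x <= 1 / 2 -> (2 * x)%:C <= `|1 - e x|.
Proof.
move=> /andP[x0 x2]; set k := Num.truncn (2 * x)^-1.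
have x2V : 1 <= (2 * x)^-1 by rewrite invf_ge1; lra.
have /andP[k_le k_gt] := truncn_itv (le_trans ler01 x2V).
have k1 : (1 <= k)%N by rewrite truncn_ge_nat // (le_trans ler01).
rewrite -/k in k_le k_gt.
have kx_le : k%:R * (2 * x) <= 1 by rewrite -ler_pdivlMr ?div1r //; lra.
have kx_gt : 1 < (k%:R + 1) * (2 * x).
  by rewrite -ltr_pdivrMr ?div1r; [rewrite natr1 | lra].
have k1R : 1 <= k%:R :> R by rewrite ler1n.
(* k is the integer part of 1 / (2 * x), which puts k * x in ]1/4, 1/2]. *)
have far : 1 <= `|1 - e (x * k%:R)|.
  apply: le_trans (normc_ge_Re _).
  rewrite eE /= -[1]/(1%:C) lecR ger0_norm; last by have := cos_le1 (2 * pi * (x * k%:R)); lra.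
  suff : cos (2 * pi * (x * k%:R)) <= cos (pi / 2 : R) by rewrite cos_pihalf; lra.
  have pi0 := pi_gt0 R.
  have half_le : 1 / 2 <= k%:R * (2 * x) by nra.
  have arg_ge : pi / 2 <= 2 * pi * (x * k%:R) by nra.
  have arg_le : 2 * pi * (x * k%:R) <= pi by nra.
  rewrite leNgt ltr_cos ?in_itv /= -?leNgt //; apply/andP; split; lra.
have pow : `|1 - e (x * k%:R)| <= `|1 - e x| * k%:R.
  rewrite e_mulrn -opprB normrN subrX1 normrM -normrN opprB ler_wpM2l //.
  apply: le_trans (ler_norm_sum _ _ _) _.
  by under eq_bigr do rewrite normrX norm_e expr1n; rewrite sumr_const card_ord.
have kC : (2 * x * k%:R)%:C <= 1%:C by rewrite lecR mulrC.
have kC0 : 0 < k%:R :> R[i] by rewrite ltr0n.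
rewrite -(ler_pM2r kC0); apply: le_trans (le_trans far pow).
by move: kC; rewrite rmorphM /= rmorph_nat.
Qed.

Lemma chord_ge x (d : R) :
  (forall m : int, d <= `|x - m%:~R|) -> (2 * d)%:C <= `|1 - e x|.
Proof.
move=> far; set m := Num.floor (x + 1 / 2).
have /andP[m_le m_gt] := floor_itv (x + 1 / 2).
rewrite -/m in m_le m_gt; rewrite intrD in m_gt.
have ex : e x = e (x - m%:~R) by rewrite e_add e_opp e_int rmorph1 mulr1.
have := far m; rewrite {}ex; set y := x - m%:~R => dy.
have y_le : `|y| <= 1 / 2 by rewrite ler_norml /y; lra.
have -> : `|1 - e y| = `|1 - e `|y| |.
  have [y0|y0] := ger0P y; first by [].
  by rewrite e_opp -[in RHS](rmorph1 (@Num.conj _)) -rmorphB norm_conjC.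
have [y0|y0] := ltP 0 `|y|.
  have := chord_ge_of_small `|y|; rewrite y0 y_le => /(_ isT); apply: le_trans.
  by rewrite lecR; lra.
by apply: le_trans (normr_ge0 _); rewrite lecR; lra.
Qed.

Lemma geometric_e_bound x (d : R) (U : nat) : 0 < d ->
  (forall m : int, d <= `|x - m%:~R|) ->
  `|\sum_(u < U) e (x * u%:R)| <= (d^-1)%:C.
Proof.
move=> d0 far.
have dC : 0 < (2 * d)%:C by rewrite ltcR; lra.
have -> : (d^-1)%:C = 2 / (2 * d)%:C.
  by rewrite rmorphM rmorph_nat invfM mulrA divff ?pnatr_eq0 // mul1r fmorphV.
rewrite ler_pdivlMr // mulrC.
have H := ler_wpM2r (normr_ge0 (\sum_(u < U) e (x * u%:R))) (chord_ge x d far).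
apply: (le_trans H).
rewrite -normrM; under eq_bigr do rewrite e_mulrn.
rewrite -opprB mulNr -subrX1 normrN (le_trans (ler_normB _ _)) //.
by rewrite normrX norm_e expr1n normr1 -natr1.
Qed.

(** * Multiples of a number close to a reduced fraction *)

(** As q does not divide h, the fraction a * h / q is at distance at least 1 / q
from the integers, while the error theta * h / q ^ 2 is at most half of that. *)
Lemma rational_approximation_far (alpha theta : R) (a : int) (q : nat) (h : int) :
    alpha = a%:~R / q%:R + theta / q%:R ^+ 2 -> coprimez a q%:Z ->
    `|theta| < 1 -> h != 0 -> (2 * `|h| <= q)%N ->
  forall m : int, (2 * q%:R)^-1 <= `|alpha * h%:~R - m%:~R|.
Proof.
move=> -> co_aq th1 h0 hq m.
have q0 : (0 < q)%N by lia.
have q0R : 0 < q%:R :> R by rewrite ltr0n.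
have num_neq0 : a * h - m * q%:Z != 0.
  apply/eqP => /eqP; rewrite subr_eq0 => /eqP eq_ah.
  have : (q%:Z %| a * h)%Z by rewrite eq_ah dvdz_mull.
  rewrite Gauss_dvdzr; last by rewrite coprimez_sym.
  by rewrite dvdzE absz_nat => /dvdn_leq; lia.
have num_ge1 : 1 <= `|(a * h - m * q%:Z)%:~R : R|.
  by rewrite -intr_norm -[1]/(1%:~R) ler_int; lia.
set t := theta / q%:R ^+ 2 * h%:~R.
have h_le : `|h%:~R : R| <= q%:R / 2.
  by rewrite -intr_norm ler_pdivlMr // mulrC -[2]/(2%:~R) -[q%:R]/((q%:Z)%:~R) -intrM ler_int; lia.
have t_le : `|t| <= (2 * q%:R)^-1.
  have -> : (2 * q%:R)^-1 = 1 / q%:R ^+ 2 * (q%:R / 2) :> R by field; lra.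
  rewrite /t !normrM normfV (ger0_norm (exprn_ge0 _ (ltW q0R))).
  have q2V : 0 <= (q%:R ^+ 2)^-1 :> R by rewrite invr_ge0 exprn_ge0 // ltW.
  by apply: ler_pM => //; [exact: mulr_ge0 | exact/ler_wpM2r/ltW].
have -> : (a%:~R / q%:R + theta / q%:R ^+ 2) * h%:~R - m%:~R
    = (a * h - m * q%:Z)%:~R / q%:R + t :> R.
  by rewrite /t intrB !intrM -pmulrn; field; lra.
have main_ge : q%:R^-1 <= `|(a * h - m * q%:Z)%:~R / q%:R : R|.
  by rewrite normrM normfV (gtr0_norm q0R) ler_peMl // invr_ge0 ltW.
have := ler_normB ((a * h - m * q%:Z)%:~R / q%:R + t) t; rewrite addrK.
have : q%:R^-1 = (2 * q%:R)^-1 + (2 * q%:R)^-1 :> R by field; lra.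
by lra.
Qed.

(** * Sums over integers with even digit sum *)

(** Within the block of index u only the v whose digit sum has the same parity as that
of u occur.  The mean square bound is applied to both parities and the
two are added, hence the factor 2; this avoids splitting the u by parity, which
would destroy the geometric sums. *)
Lemma even_blocks_bound (alpha : R) (M U : nat) (G : R[i]) : 0 <= G ->
    (forall h : int, h != 0 -> (`|h| < 2 ^ M)%N ->
      `|\sum_(u < U) e (alpha * (2 * (2 ^ M)%:Z * h)%:~R * u%:R)| <= G) ->
  `|\sum_(0 <= n < U * 2 ^ M | ~~ odd (binary_digit_sum n)) e (alpha * n%:R ^+ 2)| ^+ 2
    <= 2 * U%:R * ((2 ^ M)%:R * U%:R + (2 ^ M)%:R ^+ 2 * G).
Proof.
move=> G0 geoG; pose x (v : 'I_(2 ^ M)) (u : 'I_U) := e (alpha * (u * 2 ^ M + v)%:R ^+ 2).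
pose T b (u : 'I_U) := \sum_(v : 'I_(2 ^ M) | odd (binary_digit_sum v) == b) x v u.
have T_bound b : \sum_u `|T b u| ^+ 2 <= (2 ^ M)%:R * U%:R + (2 ^ M)%:R ^+ 2 * G.
  apply: almost_orthogonal_bound => // [v u | v w neq_vw]; first by rewrite norm_e.
  pose h := (v%:Z - w%:Z)%R.
  have h0 : h != 0 by rewrite subr_eq0 eqz_nat; apply: contraNneq neq_vw => /val_inj ->.
  have h_lt : (`|h| < 2 ^ M)%N.
    by have := ltn_ord v; have := ltn_ord w; rewrite /h; lia.
  apply: le_trans (geoG h h0 h_lt).
  rewrite (eq_bigr (fun u : 'I_U => e (alpha * (v%:R ^+ 2 - w%:R ^+ 2)) *
      e (alpha * (2 * (2 ^ M)%:Z * h)%:~R * u%:R))); last first.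
    move=> u _; rewrite -e_opp -!e_add; congr e.
    rewrite /h !intrM intrB -!pmulrn !natrD !natrM; ring.
  by rewrite -mulr_sumr normrM norm_e mul1r.
have -> : \sum_(0 <= n < U * 2 ^ M | ~~ odd (binary_digit_sum n)) e (alpha * n%:R ^+ 2)
    = \sum_(u < U) T (odd (binary_digit_sum u)) u.
  rewrite big_mkcond big_nat_mul big_mkord; apply: eq_bigr => u _.
  rewrite -{1}[(u * 2 ^ M)%N]add0n big_addn mulSn addnK big_mkord /T [RHS]big_mkcond.
  apply: eq_bigr => v _; rewrite addnC binary_digit_sum_shift // oddD.
  by rewrite -negb_eqb negbK.
apply: (@le_trans _ _ ((\sum_(u < U) `|T (odd (binary_digit_sum u)) u|) ^+ 2)).
  by rewrite ler_pXn2r ?nnegrE ?sumr_ge0 // ler_norm_sum.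
have real_T (u : 'I_U) : `|T (odd (binary_digit_sum u)) u| \is Num.real by exact: normr_real.
apply: (le_trans (sqr_sum_le _ _ _ real_T)).
rewrite [2 * _]mulrC -mulrA ler_wpM2l ?ler0n // mulr_natl mulr2n.
apply: le_trans (lerD (T_bound true) (T_bound false)).
rewrite -big_split /=; apply: ler_sum => u _.
by case: odd; rewrite ?lerDl ?lerDr exprn_ge0.
Qed.

Lemma norm_sum_e_sqr_le (alpha : R) (m n : nat) (P : pred nat) :
  `|\sum_(m <= k < n | P k) e (alpha * k%:R ^+ 2)| <= (n - m)%:R.
Proof.
apply: le_trans (ler_norm_sum _ _ _) _; under eq_bigr do rewrite norm_e.
rewrite big_mkcond -[leRHS]/((n - m)%:R) -[leRHS]mulr1 mulr_natl -sumr_const_nat.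
by apply: ler_sum => i _; case: ifP; rewrite ?ler01.
Qed.

(** The terms 1 and 2 ^ M account for n = 0, which has even digit sum but is not in
N0, and for the incomplete last block.  K stands for any upper bound of the
square root of the contribution of the complete blocks. *)
Lemma N0_sum_bound (alpha theta : R) (a : int) (q M N : nat) (K : R) :
    alpha = a%:~R / q%:R + theta / q%:R ^+ 2 -> coprimez a q%:Z -> `|theta| < 1 ->
    (4 * (2 ^ M) ^ 2 <= q)%N -> 0 <= K ->
    let U := (N %/ 2 ^ M)%N in
    2 * U%:R * ((2 ^ M)%:R * U%:R + (2 ^ M)%:R ^+ 2 * (2 * q%:R)) <= K ^+ 2 ->
  `|\sum_(1 <= n < N.+1 | n \in N0) e (alpha * n%:R ^+ 2)| <= (1 + (2 ^ M)%:R + K)%:C.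
Proof.
move=> approx co_aq th1 hq K0 U hK; set Q := (2 ^ M)%N in hq hK *.
have Q0 : (0 < Q)%N by rewrite expn_gt0.
have blocks : `|\sum_(0 <= n < U * Q | ~~ odd (binary_digit_sum n)) e (alpha * n%:R ^+ 2)|
    <= K%:C.
  rewrite -(ler_pXn2r (n := 2)) ?nnegrE ?normr_ge0 ?ler0c //.
  apply: (@le_trans _ _ (2 * U%:R * (Q%:R * U%:R + Q%:R ^+ 2 * (2 * q%:R)%:C))).
    apply: even_blocks_bound => [|h h0 h_lt]; first by rewrite ler0c mulr_ge0.
    rewrite -[2 * q%:R]invrK; apply: geometric_e_bound.
      by rewrite invr_gt0 mulr_gt0 // ltr0n; nia.
    apply: (rational_approximation_far _ _ _ _ _ approx co_aq th1); first by rewrite /Q in Q0 *; nia.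
    by rewrite -/Q in h_lt *; nia.
  move: hK; rewrite -lecR; congr (_ <= _); last by rewrite rmorphXn.
  by rewrite !(rmorphM, rmorphD, rmorphXn, rmorph_nat).
pose F n := e (alpha * n%:R ^+ 2).
have -> : \sum_(1 <= n < N.+1 | n \in N0) e (alpha * n%:R ^+ 2) =
    \sum_(0 <= n < U * Q | ~~ odd (binary_digit_sum n)) F n
    + \sum_(U * Q <= n < N.+1 | ~~ odd (binary_digit_sum n)) F n - F 0%N.
  have le_UQ : (U * Q <= N.+1)%N by rewrite (leq_trans (leq_divM _ _)).
  rewrite -big_cat_nat //= [in RHS]big_mkcond big_nat_recl //= /binary_digit_sum big_ord0 /=.
  rewrite [RHS]addrC addKr [LHS]big_mkcond big_add1 /=.
  by apply: eq_bigr => n _; rewrite inE.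
rewrite (le_trans (ler_normB _ _)) //.
rewrite !rmorphD rmorph1 rmorph_nat [1 + _]addrC addrAC norm_e lerD2r addrC.
rewrite (le_trans (ler_normD _ _)) // lerD //.
apply: le_trans (norm_sum_e_sqr_le _ _ _ _) _; rewrite ler_nat.
by have := ltn_ceil N Q0; rewrite -/U mulSn; lia.
Qed.

End Exponential.

Theorem corollary1 (R : realType) (c : R) (hc : 0 < c) :
  exists A B C : R,
    [/\ 0 < A, 0 < B, 0 < C &
     forall (X alpha : R), 2 < X ->
       (exists (a : int) (q : nat) (theta : R),
          [/\ (1 <= q)%N,
              alpha = a%:~R / q%:R + theta / q%:R ^+ 2,
              coprimez a q%:Z,
              `|theta| < 1 &
              (ln X) `^ A < q%:R <= X * (ln X) `^ (- B)]) ->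
       `|\sum_(1 <= n < (Num.truncn X).+1 | n \in N0) e (alpha * n%:R ^+ 2)|
         <= (C * (X * (ln X) `^ (- c)))%:C].
Proof.
exists (4 * c + 1), (4 * c), (4 + 4 `^ c); have pow4 := powR_gt0 c (ltr0n R 4).
split; [lra | lra | lra | move=> X alpha X2 [a [q [theta [q1 approx co_aq th1 /andP[q_gt q_le]]]]]].
have L0 : 0 < ln X by rewrite ln_gt0; lra.
set L := ln X in L0 q_gt q_le *; set p := L `^ c.
have p0 : 0 < p by exact: powR_gt0.
rewrite powRN -/p; have X0 : 0 <= X by lra.
have /andP[N_le N_gt] := truncn_itv X0; set N := Num.truncn X in N_le N_gt *.
have [L4|L4] := ltP L 4.
  apply: le_trans (norm_sum_e_sqr_le _ _ _ _ _) _.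
  rewrite subn1 -(rmorph_nat (real_complex R)) lecR; apply: le_trans N_le _.
  have p4 : p <= 4 `^ c by rewrite ge0_ler_powR ?nnegrE ?ltW.
  rewrite mulrCA ler_peMr // ler_pdivlMr // mul1r; lra.
have p1 : 1 <= p by rewrite -(powRr0 L) ler_powR; lra.
have pow4c : L `^ (4 * c) = p ^+ 4.
  by rewrite mulrC powRrM -/p -powR_mulrn // ltW.
have powA : L `^ (4 * c + 1) = p ^+ 4 * L.
  by rewrite powRD ?pow4c ?powRr1 ?ltW // (gt_eqF L0) implybT.
rewrite {}powA in q_gt; rewrite powRN {}pow4c in q_le.
have y1 : 1 <= p ^+ 2 by rewrite exprn_ege1.
(* The block length 2 ^ M is the power of 2 in ](log X)^(2c) / 2, (log X)^(2c)]. *)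
set k := Num.truncn (p ^+ 2); pose M := trunc_log 2 k.
have /andP[k_le k_gt] := truncn_itv (le_trans ler01 y1); rewrite -/k in k_le k_gt.
have k1 : (0 < k)%N by rewrite truncn_gt0.
have /andP[Q_le_k Q_gt_k] := trunc_log_bounds (isT : (1 < 2)%N) k1.
rewrite -/M in Q_le_k Q_gt_k.
have [Q Q_def] : exists Q, Q = (2 ^ M)%N by exists (2 ^ M)%N.
have Q_le : Q%:R <= p ^+ 2 by rewrite Q_def (le_trans _ k_le) // ler_nat.
have Q_gt : p ^+ 2 < 2 * Q%:R.
  by rewrite Q_def (lt_le_trans k_gt) // -natrM ler_nat -expnS.
have Q1 : 1 <= Q%:R :> R by rewrite Q_def ler1n expn_gt0.
have Q2_le : 4 * Q%:R ^+ 2 <= q%:R :> R.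
  have Qp : Q%:R ^+ 2 <= p ^+ 4.
    by rewrite (exprM _ 2 2); apply: lerXn2r => //; rewrite nnegrE; lra.
  have := ler_wpM2l (exprn_ge0 4 (ltW p0)) L4; lra.
have pV : 0 < p^-1 by rewrite invr_gt0.
have pV1 : p^-1 <= 1 by rewrite invf_le1.
rewrite -exprVn in q_le.
have pVK : p * p^-1 = 1 by rewrite divff ?gt_eqF.
set r := p^-1 in pV pV1 q_le pVK *.
pose U := (N %/ 2 ^ M)%N.
have QU_le : Q%:R * U%:R <= X.
  by apply: le_trans N_le; rewrite -natrM ler_nat Q_def mulnC leq_divM.
(* The square is bounded by (2 * 2 + 4) * (X * r) ^ 2, and 8 <= 3 ^ 2. *)
have K0 : 0 <= 3 * (X * r) by rewrite !mulr_ge0 // ltW.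
have hK : 2 * U%:R * ((2 ^ M)%:R * U%:R + (2 ^ M)%:R ^+ 2 * (2 * q%:R)) <= (3 * (X * r)) ^+ 2.
  rewrite -Q_def.
  have diag : Q%:R * U%:R ^+ 2 <= 2 * (X * r) ^+ 2.
    (* Since Q U ^ 2 = (Q U) ^ 2 / Q, with Q U <= X and 1 / Q < 2 r ^ 2. *)
    have QV : Q%:R * r ^+ 2 * 2 >= 1.
      have : (p * r) ^+ 2 <= 2 * Q%:R * r ^+ 2 by rewrite exprMn ler_wpM2r ?sqr_ge0 // ltW.
      by rewrite pVK expr1n; lra.
    have sq : (Q%:R * U%:R) ^+ 2 <= X ^+ 2 by apply: lerXn2r; rewrite // nnegrE mulr_ge0.
    have step1 : Q%:R * U%:R ^+ 2 * 1 <= Q%:R * U%:R ^+ 2 * (Q%:R * r ^+ 2 * 2).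
      by apply: ler_wpM2l => //; rewrite mulr_ge0 ?sqr_ge0.
    have step2 : r ^+ 2 * (Q%:R * U%:R) ^+ 2 <= r ^+ 2 * X ^+ 2.
      by apply: ler_wpM2l => //; rewrite sqr_ge0.
    by move: step1 step2; lra.
  have off : (Q%:R * U%:R) * (Q%:R * q%:R) <= (X * r) ^+ 2.
    have Qq : Q%:R * q%:R <= p ^+ 2 * (X * r ^+ 4) by rewrite ler_pM.
    have -> : (X * r) ^+ 2 = X * (p ^+ 2 * (X * r ^+ 4)).
      have -> : p ^+ 2 * (X * r ^+ 4) = X * r ^+ 2 * (p * r) ^+ 2 by ring.
      by rewrite pVK; ring.
    by rewrite ler_pM // mulr_ge0.
  have := sqr_ge0 (X * r); lra.
have hq : (4 * (2 ^ M) ^ 2 <= q)%N by rewrite -Q_def -(ler_nat R) natrM natrX.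
have bound := N0_sum_bound _ _ _ _ _ _ _ _ approx co_aq th1 hq K0 hK.
apply: (le_trans bound).
rewrite lecR -Q_def.
have Q_small : 1 + Q%:R <= X * r.
  have r4 : r ^+ 4 <= r.
    by rewrite exprS ler_piMr ?exprn_ile1 // ltW.
  have Xr : X * r ^+ 4 <= X * r by rewrite ler_wpM2l.
  have QQ : 1 * Q%:R <= Q%:R * Q%:R :> R by rewrite ler_wpM2r.
  have Q1_le : 1 + Q%:R <= 4 * Q%:R ^+ 2 :> R by clear -Q1 QQ; lra.
  exact: le_trans Q1_le (le_trans Q2_le (le_trans q_le Xr)).
have := mulr_ge0 (ltW pow4) (mulr_ge0 X0 (ltW pV)).
clear -Q_small; lra.
Qed.
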